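(* Suppose that every finite rank-$4$ matroid in which each pair of distinct planes intersects in a flat of rank $2$ has an extension to a modular matroid. Then every finite sticky matroid is modular.
   Context: All matroids considered have finite rank. $E(M)$ denotes the ground set of $M$ and $r_M$ its rank function. A plane is a flat of rank $3$. A finite matroid is one with finite ground set. An extension of $M$ is a matroid $N$ with $E(M)\subseteq E(N)$ whose restriction to $E(M)$ is $M$. A matroid $M$ is modular if $r_M(X)+r_M(Y)=r_M(X\cup Y)+r_M(X\cap Y)$ for all flats $X,Y$ of $M$. Given matroids $N$ and $N'$ whose restrictions to $E(N)\cap E(N')$ are equal, an amalgam of $N$ and $N'$ is a matroid on $E(N)\cup E(N')$ having both $N$ and $N'$ as restrictions. A matroid $M$ is sticky if, whenever $N$ and $N'$ are matroids whose restrictions to $E(N)\cap E(N')$ are equal to each other and isomorphic to $M$, the matroids $N$ and $N'$ have an amalgam. *)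

(* Defs.v *)
From HB Require Import structures.
From mathcomp Require Import all_boot.
From mathcomp Require Import boolp classical_sets functions cardinality.
Set Implicit Arguments.
Unset Strict Implicit.
Unset Printing Implicit Defensive.

Local Open Scope classical_set_scope.
Local Open Scope card_scope.

(* A matroid of finite rank on a possibly infinite ground set contained in the
   ambient type T; several matroids on the same T can share elements.
   The first three axioms are the usual rank axioms.  The fourth (automatic when
   the ground set is finite) excludes functions such as "0 on finite sets, 1 on
   infinite sets": the independent sets are the finite X with rank X = |X|, and
   rank X is the size of a largest independent subset of X.
   The value of rank is irrelevant on sets not contained in the ground set. *)
Record matroid (T : Type) := Matroid {
  ground : set T;
  rank : set T -> nat;
  rank_card : forall X n, X `<=` ground -> X #<= `I_n -> rank X <= n;
  rank_mono : forall X Y, X `<=` Y -> Y `<=` ground -> rank X <= rank Y;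
  rank_submod : forall X Y, X `<=` ground -> Y `<=` ground ->
    rank (X `|` Y) + rank (X `&` Y) <= rank X + rank Y;
  rank_finitary : forall X, X `<=` ground ->
    exists F, [/\ F `<=` X, finite_set F & rank F = rank X]
}.

Section Matroid.
Context {T : Type}.
Implicit Types (M N A : matroid T) (X Y : set T).

Definition finite_matroid M : Prop := finite_set (ground M).

Definition matroid_rank M : nat := rank M (ground M).

Definition flat M X : Prop :=
  X `<=` ground M /\
  forall e, ground M e -> ~ X e -> rank M X < rank M (X `|` [set e]).

Definition flat_of_rank M (k : nat) X : Prop := flat M X /\ rank M X = k.

Definition plane M X : Prop := flat_of_rank M 3 X.

Definition modular M : Prop :=
  forall X Y, flat M X -> flat M Y ->
    rank M X + rank M Y = rank M (X `|` Y) + rank M (X `&` Y).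

(* Equality of matroids: rank functions are compared on the ground set only. *)
Definition same_matroid M N : Prop :=
  ground M = ground N /\ forall X, X `<=` ground M -> rank M X = rank N X.

Lemma restrict_sub M X Y : Y `<=` ground M `&` X -> Y `<=` ground M.
Proof. by move=> h x /h []. Qed.

Definition restrict M X : matroid T :=
  @Matroid T (ground M `&` X) (rank M)
    (fun Y n sY => @rank_card T M Y n (restrict_sub sY))
    (fun Y Z sYZ sZ => @rank_mono T M Y Z sYZ (restrict_sub sZ))
    (fun Y Z sY sZ =>
       @rank_submod T M Y Z (restrict_sub sY) (restrict_sub sZ))
    (fun Y sY => @rank_finitary T M Y (restrict_sub sY)).

Definition extension M N : Prop :=
  ground M `<=` ground N /\ same_matroid (restrict N (ground M)) M.

Definition amalgam N N' A : Prop :=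
  [/\ ground A = ground N `|` ground N',
      same_matroid (restrict A (ground N)) N &
      same_matroid (restrict A (ground N')) N'].

End Matroid.

(* The bijection is between the ground sets seen as types, so that nothing is
   required of the elements of T and U outside them. *)
Definition isomorphic (T U : Type) (M : matroid T) (N : matroid U) : Prop :=
  exists2 f : ground M -> ground N, bijective f &
    forall X : set (ground M),
      rank N (set_val @` (f @` X)) = rank M (set_val @` X).

(* The ambient type T may be too small to contain the new elements of an
   extension, so M is first replaced by an isomorphic copy in some type U. *)
Definition has_modular_extension (T : Type) (M : matroid T) : Prop :=
  exists (U : Type) (M' N : matroid U),
    [/\ isomorphic M M', extension M' N & modular N].

Definition sticky (T : Type) (M : matroid T) : Prop :=
  forall (U : Type) (N N' : matroid U),
    let I := ground N `&` ground N' in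
    same_matroid (restrict N I) (restrict N' I) ->
    isomorphic (restrict N I) M ->
    exists A : matroid U, amalgam N N' A.

(* Main.v *)
(** Call a finite matroid repairable if some extension turns a nonmodular pair
of flats (X, Y) into a modular one, with intersection spanned by a set Q.

A repairable matroid M is not sticky.  Let c = r(M) and d = r(Q).  Besides the
extension containing Q, take an extension of M by sets A and B of rank c + d
that lie generically in the spans of Q and c coloops, truncated to rank
2c + d + 1, with Q deleted.  In an amalgam, modularity of X and Y over A puts Q
in the span of A, likewise in the span of B, so that A and B together have rank
at most 2(c + d) - d = 2c + d, a contradiction.

A nonmodular finite matroid is repairable, by induction on the rank.
Repairability lifts from M/e to M, so all contractions may be assumed modular,
and then M has disjoint coplanar lines L1, L2.  In rank at most 4 either two
hyperplanes form a nonmodular pair, to which points can be added freely, or the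
rank is 4 and the hypothesis on planes applies.  In rank at least 5 the missing
point p of L1 and L2 can be added: the lines zp are the intersections of the
planes spanned by z and the L_i, they are pairwise coplanar, and the flats X
with zp in the span of X and z for all z form a modular cut. *)
Require Import Defs.
From mathcomp Require Import all_boot zify.
Set Implicit Arguments.
Unset Strict Implicit.
Unset Printing Implicit Defensive.

(** * Rank functions on finite types *)

Lemma setU1_id (E : finType) (x : E) (X : {set E}) : x \in X -> x |: X = X.
Proof. by move=> xX; apply/setUidPr; rewrite sub1set. Qed.

Definition is_rank (E : finType) (r : {set E} -> nat) : Prop :=
  [/\ forall X, r X <= #|X|,
      forall X Y : {set E}, X \subset Y -> r X <= r Y &
      forall X Y, r (X :|: Y) + r (X :&: Y) <= r X + r Y].

Definition cl (E : finType) (r : {set E} -> nat) (X : {set E}) : {set E} :=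
  [set x | r (x |: X) == r X].

Definition fflat (E : finType) (r : {set E} -> nat) (X : {set E}) : bool :=
  cl r X \subset X.

(** The reverse inequality is submodularity. *)
Definition fin_modular (E : finType) (r : {set E} -> nat) : Prop :=
  forall X Y, fflat r X -> fflat r Y ->
    r X + r Y <= r (X :|: Y) + r (X :&: Y).

Section RankFunction.
Context {E : finType} {r : {set E} -> nat}.
Hypothesis hr : is_rank r.
Implicit Types (X Y Z F V W : {set E}) (x y z w e : E).

Lemma rk_card X : r X <= #|X|. Proof. by case: hr. Qed.

Lemma rk_mono X Y : X \subset Y -> r X <= r Y.
Proof. by case: hr => _ + _; apply. Qed.

Lemma rk_submod X Y : r (X :|: Y) + r (X :&: Y) <= r X + r Y.
Proof. by case: hr. Qed.

Lemma rk0 : r set0 = 0.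
Proof. by apply/eqP; rewrite -leqn0 -(cards0 E) rk_card. Qed.

(** By monotonicity, unions and intersections need only be compared by inclusion, never computed. *)
Lemma rk_submodP X Y V W : V \subset X :|: Y -> W \subset X -> W \subset Y ->
  r V + r W <= r X + r Y.
Proof.
move=> VXY WX WY; apply: leq_trans (rk_submod X Y).
by apply: leq_add; apply: rk_mono => //; rewrite subsetI WX.
Qed.

Lemma rkU1_le x X : r (x |: X) <= (r X).+1.
Proof.
have := rk_submod [set x] X; have := rk_card [set x]; rewrite cards1; lia.
Qed.

Lemma rkU1_cl x X : x \in cl r X -> r (x |: X) = r X.
Proof. by rewrite inE => /eqP. Qed.

Lemma rkU1_ncl x X : x \notin cl r X -> r (x |: X) = (r X).+1.
Proof.
rewrite inE => h; have := rkU1_le x X; have := rk_mono (subsetUr [set x] X).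
by move: h => /eqP; lia.
Qed.

Lemma in_cl x X : (x \in cl r X) = (r (x |: X) <= r X).
Proof. by rewrite inE eqn_leq (rk_mono (subsetUr _ _)) andbT. Qed.

Lemma sub_cl X : X \subset cl r X.
Proof. by apply/subsetP => x xX; rewrite inE setU1_id. Qed.

Lemma clS X Y : X \subset Y -> cl r X \subset cl r Y.
Proof.
move=> XY; apply/subsetP => x; rewrite !in_cl => xX.
have := @rk_submodP (x |: X) Y (x |: Y) X.
rewrite -setUA (setUidPr XY) subxx subsetUr XY => /(_ isT isT isT); lia.
Qed.

Lemma rkU_cl X Y : Y \subset cl r X -> r (X :|: Y) = r X.
Proof.
have [n] := ubnP #|Y|; elim: n Y => // n IHn Y; rewrite ltnS => leYn YX.
have [->|[y yY]] := set_0Vmem Y; first by rewrite setU0.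
have YyX : Y :\ y \subset cl r X by rewrite (subset_trans (subD1set _ _)).
rewrite -(setD1K yY) setUCA rkU1_cl ?IHn//.
  by move: leYn; rewrite (cardsD1 y) yY.
by apply: (subsetP (clS (subsetUl _ _))); apply: (subsetP YX).
Qed.

Lemma rk_cl X : r (cl r X) = r X.
Proof. by rewrite -{1}(setUidPr (sub_cl X)) rkU_cl. Qed.

Lemma sub_clP X Y : reflect (r (X :|: Y) <= r X) (Y \subset cl r X).
Proof.
apply: (iffP idP) => [/rkU_cl->//|XY]; apply/subsetP => y yY; rewrite in_cl.
by apply: leq_trans XY; apply: rk_mono; rewrite subUset sub1set !inE yY orbT subsetUl.
Qed.

Lemma cl_min X Y : X \subset cl r Y -> cl r X \subset cl r Y.
Proof.
move=> XY; apply: subset_trans (clS XY) _; apply/subsetP => x.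
rewrite !in_cl rk_cl => h; apply: leq_trans h.
by rewrite rk_mono// setUS// sub_cl.
Qed.

Lemma cl_flat X : fflat r (cl r X).
Proof. by rewrite /fflat cl_min. Qed.

Lemma flatE X : fflat r X -> cl r X = X.
Proof. by move=> fX; apply/eqP; rewrite eqEsubset sub_cl andbT. Qed.

Lemma flatI X Y : fflat r X -> fflat r Y -> fflat r (X :&: Y).
Proof.
move=> fX fY; rewrite /fflat subsetI; apply/andP; split.
  exact: subset_trans (clS (subsetIl _ _)) fX.
exact: subset_trans (clS (subsetIr _ _)) fY.
Qed.

Lemma cl_sub X Y : fflat r Y -> X \subset Y -> cl r X \subset Y.
Proof. by move=> fY XY; apply: subset_trans (clS XY) fY. Qed.

Lemma sub_cl_rk X Y : X \subset Y -> r Y <= r X -> Y \subset cl r X.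
Proof. by move=> XY YX; apply/sub_clP; rewrite (setUidPr XY). Qed.

Lemma flat_rk_eq X Y : fflat r X -> X \subset Y -> r Y <= r X -> X = Y.
Proof.
move=> fX XY YX; apply/eqP; rewrite eqEsubset XY.
exact: subset_trans (sub_cl_rk XY YX) fX.
Qed.

Lemma cl_exchange x y X :
  x \notin cl r X -> x \in cl r (y |: X) -> y \in cl r (x |: X).
Proof.
move=> xX xyX; rewrite inE setUCA (rkU1_cl xyX) (rkU1_ncl xX).
have := rkU1_le y X; have := rk_mono (subsetUr [set x] (y |: X)).
rewrite (rkU1_cl xyX) => _ h; have : r (x |: X) <= r (x |: (y |: X)).
  by rewrite rk_mono// setUS// subsetUr.
by rewrite (rkU1_cl xyX) (rkU1_ncl xX); lia.
Qed.

(** Otherwise exchange would put [w] in the closure of [x |: V], which lies in [F]. This removes an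
    auxiliary point chosen outside a flat after it has helped to compute a span. *)
Lemma cl_drop F V w x : fflat r F -> V \subset F -> w \notin F -> x \in F ->
  x \in cl r (w |: V) -> x \in cl r V.
Proof.
move=> fF VF wF xF xwV; apply/negPn/negP => xV; move/negP: wF; apply.
apply: (subsetP fF); apply: subsetP (cl_exchange xV xwV).
by apply: clS; rewrite subUset sub1set xF.
Qed.

(** Deleting one element lowers the rank by at most one, so no value is skipped. *)
Lemma ex_rk_sub Z k : k <= r Z -> exists2 W : {set E}, W \subset Z & r W = k.
Proof.
have [n] := ubnP #|Z|; elim: n Z => // n IHn Z; rewrite ltnS => leZn kZ.
have [/eqP->|neq] := boolP (k == r Z); first by exists Z.
have [Z0|[z zZ]] := set_0Vmem Z; first by move: kZ neq; rewrite Z0 rk0; lia.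
have [] := IHn (Z :\ z).
- by move: leZn; rewrite (cardsD1 z) zZ.
- by have := rkU1_le z (Z :\ z); rewrite setD1K//; lia.
by move=> W WZ rW; exists W => //; apply: subset_trans WZ (subD1set _ _).
Qed.

Lemma ex_nonloop Z : 0 < r Z -> exists2 e, e \in Z & r [set e] = 1.
Proof.
move=> Z0; have [W WZ rW] := ex_rk_sub Z0.
have [W0|[e0 e0W]] := set_0Vmem W; first by move: rW; rewrite W0 rk0.
have [/existsP[e /andP[eZ /eqP re]]|] := boolP [exists e, (e \in Z) && (r [set e] == 1)].
  by exists e.
rewrite negb_exists => /forallP h; suff: r Z <= r set0 by rewrite rk0; lia.
rewrite -[Z in r Z]set0U; apply/sub_clP/subsetP => z zZ; rewrite inE setU0 rk0.
by have := h z; rewrite zZ/=; have := rk_card [set z]; rewrite cards1; lia.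
Qed.

End RankFunction.

(** The point [e] stays in the ground set as a loop, so a matroid and its contractions live on the
    same type. *)
Definition contract (E : finType) (r : {set E} -> nat) (e : E) (X : {set E}) :=
  r (e |: X) - r [set e].

Lemma contract_rank (E : finType) (r : {set E} -> nat) (e : E) :
  is_rank r -> is_rank (contract r e).
Proof.
move=> hr; split=> [X|X Y XY|X Y]; rewrite /contract.
- have := rk_submod hr [set e] X; have := rk_card hr X; lia.
- by rewrite leq_sub2r// rk_mono// setUS.
have := rk_submod hr (e |: X) (e |: Y); rewrite -setUIr setUACA setUid.
have := rk_mono hr (subsetUl [set e] (X :&: Y)).
have := rk_mono hr (subsetUl [set e] (X :|: Y)).
have := rk_mono hr (subsetUl [set e] X).
have := rk_mono hr (subsetUl [set e] Y); lia.
Qed.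

Lemma contract_flat (E : finType) (r : {set E} -> nat) (e : E) (X : {set E}) :
  is_rank r -> e \in X -> fflat (contract r e) X = fflat r X.
Proof.
move=> hr eX; suff clE : cl (contract r e) X = cl r X by rewrite /fflat clE.
apply/setP => x; rewrite !inE /contract setUCA.
rewrite !(setU1_id eX); have : r [set e] <= r X by rewrite rk_mono// sub1set.
have := rk_mono hr (subsetUr [set x] X); lia.
Qed.

Definition nonmodular_pair (E : finType) (r : {set E} -> nat) (X Y : {set E}) :=
  [/\ fflat r X, fflat r Y & r (X :|: Y) + r (X :&: Y) < r X + r Y].

Lemma fin_modularPn (E : finType) (r : {set E} -> nat) :
  ~ fin_modular r -> exists X Y, nonmodular_pair r X Y.
Proof.
move=> nmod; apply: boolp.contrapT => H; apply: nmod => X Y fX fY.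
by rewrite leqNgt; apply/negP => XY; apply: H; exists X, Y.
Qed.

(** * Matroids all of whose contractions by a nonloop are modular *)

Section LocallyModular.
Context {E : finType} {r : {set E} -> nat}.
Hypothesis hr : is_rank r.
Hypothesis loc : forall e, r [set e] = 1 -> fin_modular (contract r e).

(** A nonloop of the intersection can be contracted: both flats survive and all four ranks drop by
    one. *)
Lemma locally_modular_pair X Y : fflat r X -> fflat r Y -> 0 < r (X :&: Y) ->
  r X + r Y <= r (X :|: Y) + r (X :&: Y).
Proof.
move=> fX fY /(ex_nonloop hr)[e]; rewrite inE => /andP[eX eY] re.
have := loc re; move=> /(_ X Y); rewrite !contract_flat// => /(_ fX fY).
rewrite /contract !setU1_id ?inE ?eX ?eY// re.
have eV (Z : {set E}) : e \in Z -> 0 < r Z.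
  by move=> eZ; rewrite -re rk_mono// sub1set.
have := eV X eX; have := eV Y eY; have := eV (X :|: Y); have := eV (X :&: Y).
rewrite !inE eX eY => /(_ isT) + /(_ isT); lia.
Qed.

Lemma nonmodular_pair_disjoint X Y : nonmodular_pair r X Y -> r (X :&: Y) = 0.
Proof.
move=> [fX fY XY]; apply/eqP; rewrite eqn0Ngt; apply/negP => h.
by have := locally_modular_pair fX fY h; lia.
Qed.

(** For a point [x] of [X] outside [Y], the flat [X] and the span of [x |: Y] share [x], hence form
    a modular pair. As [X] and [Y] are not modular, this pair meets in rank at least 2, which leaves
    room for a line. *)
Lemma nonmodular_pair_line X Y : nonmodular_pair r X Y ->
  exists L, [/\ nonmodular_pair r L Y, r L = 2 & r (L :|: Y) <= (r Y).+1].
Proof.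
move=> nXY; have d0 := nonmodular_pair_disjoint nXY; case: nXY => fX fY XY.
have X1 : 0 < r X.
  by have := rk_mono hr (subsetUr X Y); lia.
have [x xX rx] := ex_nonloop hr X1.
have xY : x \notin Y.
  apply/negP => xY; suff: r [set x] <= r (X :&: Y) by lia.
  by rewrite rk_mono// sub1set inE xX.
pose Z := X :&: cl r (x |: Y).
have fZ : fflat r Z by apply: flatI => //; exact: cl_flat.
have Z1 : 0 < r Z.
  rewrite -rx rk_mono// sub1set inE xX (subsetP (sub_cl _))//.
  by rewrite !inE eqxx.
have rxY : r (x |: Y) = (r Y).+1.
  by apply: rkU1_ncl => //; apply: contra xY; apply: (subsetP fY).
have Z2 : 1 < r Z.
  have := locally_modular_pair fX (cl_flat hr (x |: Y)) Z1.
  have -> : r (X :|: cl r (x |: Y)) = r (X :|: Y).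
    apply/anti_leq; rewrite [X in _ && X]rk_mono ?andbT//; last first.
      by apply: setUS; apply: subset_trans (subsetUr _ _) (sub_cl _).
    have <- : r (cl r (X :|: Y)) = r (X :|: Y) by rewrite rk_cl.
    apply: rk_mono => //; rewrite subUset (subset_trans _ (sub_cl _)) ?subsetUl//=.
    by apply: clS => //; rewrite setSU// sub1set.
  by rewrite rk_cl// rxY -/Z; lia.
have [W WZ rW] := ex_rk_sub hr Z2.
have WX : cl r W \subset X.
  by apply: cl_sub => //; apply: subset_trans WZ (subsetIl _ _).
have WY : r (cl r W :|: Y) <= (r Y).+1.
  rewrite -rxY -(rk_cl hr (x |: Y)) rk_mono// subUset; apply/andP; split.
    by apply: cl_min => //; apply: subset_trans WZ (subsetIr _ _).
  by apply: subset_trans (subsetUr _ _) (sub_cl _).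
exists (cl r W); split=> //; last by rewrite rk_cl.
split=> //; first exact: cl_flat.
have : r (cl r W :&: Y) <= r (X :&: Y) by rewrite rk_mono// setSI.
by rewrite rk_cl// rW; lia.
Qed.

(** Each flat of a nonmodular pair is reduced to a line in turn; the second time the other flat is
    already a line, so the union has rank at most 3. *)
Lemma ex_disjoint_coplanar_lines : ~ fin_modular r ->
  exists L1 L2, [/\ fflat r L1, fflat r L2, r L1 = 2, r L2 = 2 &
    r (L1 :|: L2) = 3 /\ r (L1 :&: L2) = 0].
Proof.
move=> /fin_modularPn[X [Y /nonmodular_pair_line[L1 [nLY rL1 _]]]].
have nYL : nonmodular_pair r Y L1.
  case: nLY => fL fY h; split=> //.
  by rewrite setUC setIC [ltnRHS]addnC.
have [L2 [nLL rL2]] := nonmodular_pair_line nYL.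
have LL := nonmodular_pair_disjoint nLL; case: nLL => f2 f1 _; rewrite rL1 => U3.
exists L1, L2; split=> //; rewrite setUC setIC; split=> //.
(* In rank 2 the flat [L2] would contain [L1], although they meet in rank 0. *)
apply/anti_leq; rewrite U3 ltnNge; apply/negP => U2.
have L21 : L2 = L2 :|: L1.
  by apply: (flat_rk_eq hr f2 (subsetUl _ _)); lia.
have : r L1 <= r (L2 :&: L1).
  by rewrite rk_mono// subsetI subxx L21 subsetUr.
lia.
Qed.

End LocallyModular.

(** * Extensions and repairability *)

Definition lpart (E D : finType) (Z : {set E + D}) : {set E} := [set x | inl x \in Z].
Definition rpart (E D : finType) (Z : {set E + D}) : {set D} := [set d | inr d \in Z].
Definition join (E D : finType) (X : {set E}) (S : {set D}) : {set E + D} :=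
  [set u | match u with inl x => x \in X | inr d => d \in S end].

Section Join.
Context {E D : finType}.
Implicit Types (X Y : {set E}) (S T : {set D}) (Z W : {set E + D}).

Lemma lpart_join X S : lpart (join X S) = X.
Proof. by apply/setP => x; rewrite !inE. Qed.

Lemma rpart_join X S : rpart (join X S) = S.
Proof. by apply/setP => x; rewrite !inE. Qed.

Lemma join_part Z : join (lpart Z) (rpart Z) = Z.
Proof. by apply/setP => -[x|x]; rewrite !inE. Qed.

Lemma joinU X Y S T : join X S :|: join Y T = join (X :|: Y) (S :|: T).
Proof. by apply/setP => -[x|x]; rewrite !inE. Qed.

Lemma joinI X Y S T : join X S :&: join Y T = join (X :&: Y) (S :&: T).
Proof. by apply/setP => -[x|x]; rewrite !inE. Qed.

Lemma joinS X Y S T : X \subset Y -> S \subset T -> join X S \subset join Y T.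
Proof.
by move=> /subsetP XY /subsetP ST; apply/subsetP => -[x|x]; rewrite !inE; auto.
Qed.

Lemma join0 : join set0 set0 = set0 :> {set E + D}.
Proof. by apply/setP => -[x|x]; rewrite !inE. Qed.

Lemma lpartU Z W : lpart (Z :|: W) = lpart Z :|: lpart W.
Proof. by apply/setP => x; rewrite !inE. Qed.

Lemma rpartU Z W : rpart (Z :|: W) = rpart Z :|: rpart W.
Proof. by apply/setP => x; rewrite !inE. Qed.

Lemma lpartI Z W : lpart (Z :&: W) = lpart Z :&: lpart W.
Proof. by apply/setP => x; rewrite !inE. Qed.

Lemma rpartI Z W : rpart (Z :&: W) = rpart Z :&: rpart W.
Proof. by apply/setP => x; rewrite !inE. Qed.

Lemma lpartS Z W : Z \subset W -> lpart Z \subset lpart W.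
Proof. by move=> /subsetP h; apply/subsetP => x; rewrite !inE; apply: h. Qed.

Lemma rpartS Z W : Z \subset W -> rpart Z \subset rpart W.
Proof. by move=> /subsetP h; apply/subsetP => x; rewrite !inE; apply: h. Qed.

Lemma card_join X S : #|join X S| = #|X| + #|S|.
Proof.
rewrite -sum1_card big_sumType/= -!sum1_card; congr (_ + _);
  by apply: eq_bigl => x; rewrite inE.
Qed.

Lemma card_part Z : #|Z| = #|lpart Z| + #|rpart Z|.
Proof. by rewrite -card_join join_part. Qed.

Lemma is_rank_join (g : {set E} -> {set D} -> nat) :
  (forall X S, g X S <= #|X| + #|S|) ->
  (forall X Y S T, X \subset Y -> S \subset T -> g X S <= g Y T) ->
  (forall X Y S T, g (X :|: Y) (S :|: T) + g (X :&: Y) (S :&: T) <= g X S + g Y T) ->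
  is_rank (fun Z => g (lpart Z) (rpart Z)).
Proof.
move=> gc gm gs; split=> [Z|Z W ZW|Z W].
- by rewrite card_part.
- by apply: gm; [exact: lpartS|exact: rpartS].
by rewrite lpartU rpartU lpartI rpartI.
Qed.

End Join.

(** [Q] stands for the intersection of the spans of [X] and [Y] in the extension [k]. By
    submodularity the first inequality of the last clause is an equality, and the second then says
    that the pair is not modular for [r]. *)
Definition repairable (E : finType) (r : {set E} -> nat) : Prop :=
  exists (D : finType) (k : {set E + D} -> nat),
    [/\ is_rank k, forall X, k (join X set0) = r X &
    exists X Y Q, [/\ fflat r X, fflat r Y,
      k (join X set0 :|: Q) <= r X, k (join Y set0 :|: Q) <= r Y &
      r X + r Y <= r (X :|: Y) + k Q /\ r (X :&: Y) < k Q]].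

(** The extension [k] of the contraction lifts to the largest extension of [r] whose contraction by
    [e] is [k], and [e] joins the repairing set. *)
Lemma repairable_contract (E : finType) (r : {set E} -> nat) (e : E) :
  is_rank r -> r [set e] = 1 -> repairable (contract r e) -> repairable r.
Proof.
move=> hr re [D [k [hk kr [X [Y [Q [fX fY QX QY [XYQ XYlt]]]]]]]].
have ke : inl e \in cl k set0.
  rewrite in_cl// setU0; have -> : [set inl e] = join [set e] set0 :> {set E + D}.
    by apply/setP => -[x|x]; rewrite !inE.
  by rewrite kr /contract setUid subnn.
have kUe Z : k (inl e |: Z) = k Z.
  by rewrite rkU1_cl//; apply: subsetP ke; apply: clS => //; exact: sub0set.
have rUe V : r (e |: V) = (contract r e V).+1.
  by have := rk_mono hr (subsetUl [set e] V); rewrite /contract re; lia.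
(* Both terms are forced upper bounds: one from contracting [e], the other from restricting to
   [E]. *)
pose g V (S : {set D}) := minn (k (join V S)).+1 (r V + #|S|).
pose k' (Z : {set E + D}) := g (lpart Z) (rpart Z).
have k'E V S : k' (join V S) = g V S by rewrite /k' lpart_join rpart_join.
have hk' : is_rank k'.
  apply: is_rank_join => [V S|V W S T VW ST|V W S T].
  - by rewrite /g; have := rk_card hr V; lia.
  - rewrite /g; have := rk_mono hk (joinS VW ST); have := rk_mono hr VW.
    by have := subset_leq_card ST; lia.
  (* marginal values of [r] dominate those of [k] *)
  have marg V1 V2 S1 S2 : k (join (V1 :|: V2) (S1 :|: S2)) + r (V1 :&: V2)
      + #|S1 :&: S2| <= k (join V1 S1) + r V2 + #|S2|.
    have := rk_submod hr (e |: (V1 :&: V2)) V2; rewrite -setUA (setUidPr (subsetIr _ _)).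
    have h : V1 :&: V2 \subset (e |: V1 :&: V2) :&: V2.
      by rewrite subsetI subsetUr subsetIr.
    have := rk_mono hr h; rewrite !rUe -!kr.
    have := rk_submod hk (join V1 S1) (join V2 set0).
    rewrite joinU joinI setI0 setU0.
    have := rk_submod hk (join (V1 :|: V2) S1) (join set0 (S2 :\: S1)).
    rewrite joinU setU0; have -> : S1 :|: S2 :\: S1 = S1 :|: S2.
      by apply/setP => x; rewrite !inE; case: (x \in S1).
    have := rk_card hk (join set0 (S2 :\: S1)); rewrite card_join cards0.
    by have := cardsID S1 S2; rewrite setIC; lia.
  have := rk_submod hk (join V S) (join W T); rewrite joinU joinI.
  have := rk_submod hr V W; have := cardsUI S T.
  have := marg V W S T; have := marg W V T S.
  by rewrite [W :|: V]setUC [W :&: V]setIC [T :|: S]setUC [T :&: S]setIC /g; lia.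
exists D, k'; split=> // [V|].
  rewrite k'E /g cards0 kr addn0; apply/minn_idPr.
  by rewrite -rUe; apply: rk_mono => //; exact: subsetUr.
(* Once [e] is present, [r] exceeds [k] by one on the left part, so the first term is the
   minimum. *)
have k'Ue (Z : {set E + D}) : inl e \in Z -> k' Z = (k Z).+1.
  rewrite -[Z]join_part => eZ; rewrite k'E /g.
  have eV : e |: lpart Z = lpart Z by apply: setU1_id; move: eZ; rewrite !inE.
  rewrite -[in X in minn _ X]eV rUe -kr.
  have := rk_submod hk (join (lpart Z) set0) (join set0 (rpart Z)).
  rewrite joinU setU0 set0U; have := rk_card hk (join set0 (rpart Z)).
  by rewrite card_join cards0; lia.
have feX V : fflat (contract r e) V -> e \in V.
  move=> fV; apply: (subsetP fV); rewrite in_cl; last exact: contract_rank.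
  by rewrite /contract setUA setUid.
have eX := feX X fX; have eY := feX Y fY.
have rV (V : {set E}) : e \in V -> r V = (contract r e V).+1.
  by move=> eV; rewrite -rUe setU1_id.
(* With [e] in every set involved, all ranks exceed those in the contraction by exactly one. *)
exists X, Y, (inl e |: Q); rewrite contract_flat// in fX; rewrite contract_flat// in fY.
rewrite !k'Ue ?inE ?eqxx ?orbT ?eX ?eY// kUe !rV ?inE ?eX ?eY//.
by split=> //; [rewrite setUCA kUe|rewrite setUCA kUe|split; lia].
Qed.

(** The points of [D] are added as freely as possible in the spans of both [X] and [Y], in just the
    number that brings the intersection to the modular rank [r setT - 2]. *)
Lemma repairable_hyperplanes (E : finType) (r : {set E} -> nat) (X Y : {set E}) :
  is_rank r -> nonmodular_pair r X Y ->
  (r X).+1 = r setT -> (r Y).+1 = r setT -> repairable r.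
Proof.
move=> hr [fX fY XYlt] rX rY.
have [D cD] : exists D : finType, #|D| = r setT - 2 - r (X :&: Y).
  by exists 'I_(r setT - 2 - r (X :&: Y)); rewrite card_ord.
have rXY : r (X :|: Y) = r setT.
  have := rk_mono hr (subsetT (X :|: Y)).
  have := rk_mono hr (subsetIl X Y).
  have [XsY|nXY] := boolP (X \subset Y).
    by move: XYlt; rewrite (setUidPr XsY) (setIidPl XsY); lia.
  have [x xX xY] := subsetPn nXY.
  have : x \notin cl r Y by apply: contra xY; apply: (subsetP fY).
  move=> /(rkU1_ncl hr) rxY.
  have : r (x |: Y) <= r (X :|: Y) by rewrite rk_mono// setSU// sub1set.
  by lia.
pose small (V : {set E}) := (V \subset X) || (V \subset Y).
(* The most that the rank can become when points of [D] are added: subsets of [X] or [Y] stay in a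
   hyperplane. *)
pose h (V : {set E}) := if small V then (r setT).-1 else r setT.
pose g (V : {set E}) (S : {set D}) := minn (r V + #|S|) (h V).
have hge V : r V <= h V.
  rewrite /h /small; have := rk_mono hr (subsetT V).
  by case: ifP => [/orP[]/(rk_mono hr)|_]; lia.
have smallS (V W : {set E}) : V \subset W -> small W -> small V.
  by move=> VW /orP[] WX; apply/orP; [left|right]; exact: subset_trans VW WX.
have hS (V W : {set E}) : V \subset W -> h V <= h W.
  move=> VW; rewrite /h; case: ifP => [_|nV]; first by case: ifP; lia.
  by case: ifP => // /(smallS _ _ VW); rewrite nV.
(* a set not contained in a flat loses rank when intersected with it *)
have mix V W : h (V :|: W) + r (V :&: W) <= r V + h W.
  have rI := rk_mono hr (subsetIl V W).
  have [sVW|nVW] := boolP (small (V :|: W)).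
    have : h (V :|: W) <= h W by rewrite /h sVW (smallS _ _ (subsetUr V W) sVW).
    by lia.
  have : h (V :|: W) = r setT by rewrite /h (negbTE nVW).
  have [sW|nW] := boolP (small W); last first.
    have : h W = r setT by rewrite /h (negbTE nW).
    by lia.
  have : h W = (r setT).-1 by rewrite /h sW.
  suff : r (V :&: W) < r V by lia.
  have aux (H : {set E}) : fflat r H -> W \subset H -> ~~ (V \subset H) -> r (V :&: W) < r V.
    move=> fH WH /subsetPn[v vV vH].
    have vVW : v \notin cl r (V :&: W).
      apply: contra vH; apply: subsetP; apply: cl_sub => //.
      exact: subset_trans (subsetIr _ _) WH.
    rewrite -(rkU1_ncl hr vVW) rk_mono// subUset sub1set vV.
    exact: subsetIl.
  move: nVW; rewrite /small negb_or !subUset => /andP[nX nY].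
  case/orP: sW => WH; move: nX nY; rewrite WH andbT => nX nY.
    exact: (aux X).
  exact: (aux Y).
(* The size of [D] matters here: [r (X :&: Y)] and [#|D|] add up to [r setT - 2]. *)
have cross (V W : {set E}) (S T : {set D}) : V \subset X -> W \subset Y ->
    r setT + r (V :&: W) + #|S :&: T| <= (r setT).-1 + (r setT).-1.
  move=> VX WY; have : r (V :&: W) <= r (X :&: Y) by rewrite rk_mono// setISS.
  have : #|S :&: T| <= #|D| by exact: max_card.
  by lia.
pose k (Z : {set E + D}) := g (lpart Z) (rpart Z).
have kE V S : k (join V S) = g V S by rewrite /k lpart_join rpart_join.
have hk : is_rank k.
  apply: is_rank_join => [V S|V W S T VW ST|V W S T].
  - by rewrite /g; have := rk_card hr V; lia.
  - by rewrite /g; have := rk_mono hr VW; have := subset_leq_card ST; have := hS _ _ VW; lia.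
  (* If both sets are small, their union can fail to be small only when they lie in different
     hyperplanes, where [cross] applies. *)
  have hh : h (V :|: W) + minn (r (V :&: W) + #|S :&: T|) (h (V :&: W)) <= h V + h W.
    have [sV|nV] := boolP (small V); last first.
      have : h V = r setT by rewrite /h (negbTE nV).
      have : h (V :|: W) <= r setT by rewrite /h; case: ifP; lia.
      by have := hS _ _ (subsetIr V W); lia.
    have [sW|nW] := boolP (small W); last first.
      have : h W = r setT by rewrite /h (negbTE nW).
      have : h (V :|: W) <= r setT by rewrite /h; case: ifP; lia.
      by have := hS _ _ (subsetIl V W); lia.
    have -> : h V = (r setT).-1 by rewrite /h sV.
    have -> : h W = (r setT).-1 by rewrite /h sW.
    have [sVW|nVW] := boolP (small (V :|: W)).
      rewrite {1}/h sVW.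
      by have := smallS _ _ (subset_trans (subsetIl V W) (subsetUl V W)) sVW; rewrite /h => ->; lia.
    rewrite {1}/h (negbTE nVW).
    move: nVW; rewrite /small negb_or !subUset.
    case/orP: sV => V1; case/orP: sW => W1; rewrite V1 W1 ?andbF//= => _.
      by have := cross _ _ S T V1 W1; lia.
    by have := cross _ _ S T W1 V1; rewrite setIC; lia.
  have := rk_submod hr V W; have := cardsUI S T; have := mix V W; have := mix W V.
  rewrite [W :|: V]setUC [W :&: V]setIC.
  have := subset_leq_card (subsetIl S T); have := subset_leq_card (subsetIr S T).
  by move: hh; rewrite /g; lia.
exists D, k; split=> // [V|].
  by rewrite kE /g cards0 addn0; apply/minn_idPl.
have hX : h X = (r setT).-1 by rewrite /h /small subxx.
have hY : h Y = (r setT).-1 by rewrite /h /small subxx orbT.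
exists X, Y, (join (X :&: Y) setT); split=> //.
- by rewrite joinU (setUidPl (subsetIl _ _)) kE /g hX; lia.
- by rewrite joinU (setUidPl (subsetIr _ _)) kE /g hY; lia.
rewrite kE /g rXY cardsT cD {1 2}/h /small subsetIl /=.
by move: XYlt; rewrite rXY; lia.
Qed.

(** * Adding the missing point in rank at least 5 *)

(** Crapo's single-element extension: [m] is a modular cut read on arbitrary sets, its first two
    conditions making it depend only on the closure. The new point is spanned by the sets satisfying
    [m]. *)
Lemma modular_cut_rank (E : finType) (r : {set E} -> nat) (m : pred {set E}) :
  is_rank r ->
  (forall X Y : {set E}, X \subset Y -> m X -> m Y) ->
  (forall X Y : {set E}, X \subset Y -> r X = r Y -> m Y -> m X) ->
  (forall X Y, m X -> m Y -> r X + r Y = r (X :|: Y) + r (X :&: Y) -> m (X :&: Y)) ->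
  is_rank (fun Z : {set E + unit} =>
    r (lpart Z) + ((tt \in rpart Z) && ~~ m (lpart Z))).
Proof.
move=> hr mS mcl mI.
apply: (is_rank_join (g := fun X S => r X + ((tt \in S) && ~~ m X)))
    => [X S|X Y S T XY ST|X Y S T].
- rewrite (cardsD1 tt S); have := rk_card hr X.
  by case: (tt \in S); case: (m X) => /=; lia.
- have := rk_mono hr XY; have := mS _ _ XY; have := mcl _ _ XY.
  have := subsetP ST tt.
  case: (tt \in S) => [/(_ isT)->|_] /=; last by lia.
  case: (m X); case: (m Y) => /=; lia.
rewrite !inE; have := rk_submod hr X Y; have := mI X Y.
have := mS _ _ (subsetUl X Y); have := mS _ _ (subsetUr X Y).
by case: (m X); case: (m Y); case: (m (X :|: Y)); case: (m (X :&: Y));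
  case: (tt \in S); case: (tt \in T) => /=; lia.
Qed.

Section Bundle.
Context {E : finType} {r : {set E} -> nat}.
Hypothesis hr : is_rank r.
Hypothesis r_ge5 : 5 <= r setT.
Context {L1 L2 : {set E}}.
Hypotheses (fL1 : fflat r L1) (fL2 : fflat r L2).
Hypotheses (rL1 : r L1 = 2) (rL2 : r L2 = 2).
Hypothesis rL12 : r (L1 :|: L2) = 3.
Implicit Types (X Y V W : {set E}) (x z w : E).

Let P := cl r (L1 :|: L2).
(* the line joining [z] to the missing common point [p] of [L1] and [L2] *)
Let L z := cl r (z |: L1) :&: cl r (z |: L2).

Hypothesis rL_ge2 : forall z, z \notin P -> 2 <= r (L z).

Let fP : fflat r P. Proof. exact: cl_flat. Qed.

Let ncl_z z : z \notin P -> z \notin cl r P.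
Proof. by apply: contra; apply: (subsetP fP). Qed.

Let L1P : L1 \subset P. Proof. exact: subset_trans (subsetUl _ _) (sub_cl _). Qed.
Let L2P : L2 \subset P. Proof. exact: subset_trans (subsetUr _ _) (sub_cl _). Qed.

Let fL z : fflat r (L z). Proof. by apply: flatI => //; exact: cl_flat. Qed.

Let L_zP z : L z \subset cl r (z |: P).
Proof. by apply: subset_trans (subsetIl _ _) _; apply: clS => //; exact: setUS. Qed.

Let exchP z w : z \notin P -> z \in cl r (w |: P) -> w \in cl r (z |: P).
Proof. by move=> zP; apply: cl_exchange => //; exact: ncl_z. Qed.

Let clU1 z V W : z \in cl r W -> V \subset cl r W -> cl r (z |: V) \subset cl r W.
Proof. by move=> zW VW; apply: cl_min => //; rewrite subUset sub1set zW. Qed.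

Let clxx z V : z \in cl r (z |: V).
Proof. by rewrite (subsetP (sub_cl _))// setU11. Qed.

Let subclU1 z V : V \subset cl r (z |: V).
Proof. exact: subset_trans (subsetUr _ _) (sub_cl _). Qed.

(** [W] already has the largest rank that submodularity allows for the intersection of the spans. *)
Let capcl X Y W : W \subset cl r X -> W \subset cl r Y ->
  r X + r Y <= r (X :|: Y) + r W -> cl r X :&: cl r Y \subset cl r W.
Proof.
move=> WX WY XYW; apply: sub_cl_rk => //; first by rewrite subsetI WX.
have := rk_submod hr (cl r X) (cl r Y); rewrite !rk_cl//.
have : r (X :|: Y) <= r (cl r X :|: cl r Y) by rewrite rk_mono// setUSS// sub_cl.
by lia.
Qed.

(** The span of [w |: P] has rank at most 4, below that of the matroid. Such points reduce the
    general case to the skew one. *)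
Let ex_outside w : exists w', w' \notin cl r (w |: P).
Proof.
have : ~~ (setT \subset cl r (w |: P)).
  apply/negP => /(rk_mono hr); rewrite rk_cl//.
  by have := rkU1_le hr w P; rewrite rk_cl// rL12; lia.
by case/subsetPn => w' _ ?; exists w'.
Qed.

Let ex_nP : exists w, w \notin P.
Proof.
have : ~~ (setT \subset P).
  by apply/negP => /(rk_mono hr); rewrite rk_cl// rL12; lia.
by case/subsetPn => w' _ ?; exists w'.
Qed.

(** The spans of [w], [z] and each [L1], [L2] have rank at most 4 and a union of rank 5, so they
    meet in rank at most 3; [z] and [L w] fill this intersection. *)
Let coplanar_skew w z : w \notin P -> z \notin cl r (w |: P) ->
  L z \subset cl r (z |: L w).
Proof.
move=> wP zwP.
have LwP x : x \in L w -> x \in cl r (w |: P) by apply: subsetP.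
apply: (@subset_trans _ _ (mem (cl r (z |: (w |: L1)) :&: cl r (z |: (w |: L2))))).
  by apply: setISS; apply: clS => //; rewrite setUS// subsetUr.
have sub j : L w \subset cl r (w |: j) -> z |: L w \subset cl r (z |: (w |: j)).
  move=> h; rewrite subUset sub1set clxx.
  by apply: subset_trans h _; apply: clS => //; exact: subsetUr.
apply: capcl; [exact/sub/subsetIl|exact/sub/subsetIr|].
have -> : r (z |: L w) = (r (L w)).+1.
  by apply: rkU1_ncl => //; apply: contra zwP => /(subsetP (fL _)) /LwP.
have := rL_ge2 wP.
have -> : z |: (w |: L1) :|: (z |: (w |: L2)) = z |: (w |: (L1 :|: L2)).
  by rewrite !setUA; apply/setP => x; rewrite !inE; do 4![case: (x \in _) || case: (x == _)].
have -> : r (z |: (w |: (L1 :|: L2))) = 5.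
  rewrite rkU1_ncl//; last first.
    by apply: contra zwP; apply: subsetP; apply: clS => //; rewrite setUS// sub_cl.
  by rewrite rkU1_ncl ?rL12.
have := rkU1_le hr z (w |: L1); have := rkU1_le hr w L1.
have := rkU1_le hr z (w |: L2); have := rkU1_le hr w L2.
by rewrite rL1 rL2; lia.
Qed.

(** If [z] lies in the span of [w |: P], a point [w'] outside links the two lines by two skew steps
    and is then dropped. *)
Let coplanar w z : w \notin P -> z \notin P -> L z \subset cl r (z |: L w).
Proof.
move=> wP zP.
have [zwP|] := boolP (z \in cl r (w |: P)); last exact: coplanar_skew.
have [w' w'P] := ex_outside w.
have w'nP : w' \notin P by apply: contra w'P; apply: subsetP.
have zw'P : z \notin cl r (w' |: P).
  apply: contra w'P => /(exchP zP); apply: subsetP.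
  by apply: clU1.
apply/subsetP => x xLz; apply: (@cl_drop _ _ hr (cl r (w |: P)) _ w') => //.
- exact: cl_flat.
- by rewrite subUset sub1set zwP L_zP.
- have := subsetP (L_zP z) _ xLz; apply: subsetP.
  by apply: clU1.
have := subsetP (coplanar_skew w'nP zw'P) _ xLz; apply: subsetP; rewrite setUCA.
apply: clU1 => //.
by apply: subset_trans (coplanar_skew wP w'P) _; apply: clS => //; exact: subsetUr.
Qed.

(** The sets that are to span the missing point [p]. *)
Let m X := [forall z, (z \notin P) ==> (L z \subset cl r (z |: X))].

Let mP X : reflect (forall z, z \notin P -> L z \subset cl r (z |: X)) (m X).
Proof. by apply: (iffP forallP) => h z; have := h z => /implyP. Qed.

(** Coplanarity of the lines carries the inclusion from [w] to every other [z]. *)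
Let m_in V w : w \notin P -> w \in V -> L w \subset cl r V -> m V.
Proof.
move=> wP wV LwV; apply/mP => z zP; apply: subset_trans (coplanar wP zP) _.
apply: clU1 => //; apply: subset_trans LwV _; apply: clS => //; exact: subsetUr.
Qed.

(** For subsets of the plane one test point is enough: the inclusion passes to every skew [z], and
    to the others through a third point [w']. *)
Let m_plane V w : w \notin P -> V \subset P -> L w \subset cl r (w |: V) -> m V.
Proof.
have step w' z : w' \notin P -> z \notin cl r (w' |: P) -> V \subset P ->
    L w' \subset cl r (w' |: V) -> L z \subset cl r (z |: V).
  move=> wP zwP VP LwV.
  have zP : z \notin P by apply: contra zwP; apply: subsetP.
  apply/subsetP => x xLz; apply: (@cl_drop _ _ hr (cl r (z |: P)) _ w') => //.
  - exact: cl_flat.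
  - by rewrite subUset sub1set clxx (subset_trans VP).
  - by apply: contra zwP; exact: exchP.
  - exact: subsetP (L_zP z) _ xLz.
  have := subsetP (coplanar_skew wP zwP) _ xLz; apply: subsetP.
  rewrite setUCA; apply: clU1 => //.
  by apply: subset_trans LwV _; apply: clS => //; exact: subsetUr.
move=> wP VP LwV; apply/mP => z zP.
have [zwP|zwP] := boolP (z \in cl r (w |: P)); last exact: (step w).
have [w' w'P] := ex_outside w.
apply: (step w') => //; last exact: (step w).
  by apply: contra w'P; apply: subsetP.
by apply: contra w'P => /(exchP zP); apply: subsetP; exact: clU1.
Qed.

Let mS X Y : X \subset Y -> m X -> m Y.
Proof.
move=> XY /mP mX; apply/mP => z zP; apply: subset_trans (mX z zP) _.
by apply: clS => //; exact: setUS.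
Qed.

Let mcl X Y : X \subset Y -> r X = r Y -> m Y -> m X.
Proof.
move=> XY rXY /mP mY; apply/mP => z zP; apply: subset_trans (mY z zP) _.
apply: clU1 => //; apply: (@subset_trans _ _ (mem (cl r X))).
  by apply: sub_cl_rk => //; rewrite rXY.
by apply: clS => //; exact: subsetUr.
Qed.

(** The line [L w] lies in the spans of [w |: X] and [w |: Y]. It remains to choose [w] so that
    these form a modular pair whose intersection is spanned by [w |: (X :&: Y)]. *)
Let mI X Y : m X -> m Y -> r X + r Y = r (X :|: Y) + r (X :&: Y) -> m (X :&: Y).
Proof.
have [VP|nVP] := boolP (X :&: Y \subset P); last first.
  move=> /mP mX /mP mY XY; have [w wV wP] := subsetPn nVP.
  apply: (m_in wP wV).
  have wX : w \in X by move: wV; rewrite inE => /andP[].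
  have wY : w \in Y by move: wV; rewrite inE => /andP[].
  apply: (@subset_trans _ _ (mem (cl r X :&: cl r Y))).
    by rewrite subsetI -{1}(setU1_id wX) -{1}(setU1_id wY) mX// mY.
  by apply: capcl; rewrite ?XY// (subset_trans _ (sub_cl _)) ?subsetIl ?subsetIr.
have rV w : w \notin P -> r (w |: (X :&: Y)) = (r (X :&: Y)).+1.
  by move=> wP; rewrite rkU1_ncl//; apply: contra wP; apply: subsetP; exact: cl_sub.
have main w : m X -> m Y -> w \notin P ->
    r (w |: X) + r (w |: Y) <= r (w |: (X :|: Y)) + (r (X :&: Y)).+1 -> m (X :&: Y).
  move=> /mP mX /mP mY wP XY; apply: (m_plane wP VP).
  apply: (@subset_trans _ _ (mem (cl r (w |: X) :&: cl r (w |: Y)))).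
    by rewrite subsetI mX// mY.
  apply: capcl; [| |rewrite rV//].
  - by apply: subset_trans (sub_cl _); rewrite setUS// subsetIl.
  - by apply: subset_trans (sub_cl _); rewrite setUS// subsetIr.
  by rewrite setUACA setUid.
move=> mX mY XY.
(* If the union lies in [P], any outside [w] raises all four ranks by one. Otherwise [w] is taken in
   the union, so that only one of the two sets can gain rank. *)
have [XYP|/subsetPn[w wXY wP]] := boolP (X :|: Y \subset P).
  have [w wP] := ex_nP; apply: (main w) => //.
  have -> : r (w |: (X :|: Y)) = (r (X :|: Y)).+1.
    by rewrite rkU1_ncl//; apply: contra wP; apply: subsetP; exact: cl_sub.
  by have := rkU1_le hr w X; have := rkU1_le hr w Y; lia.
apply: (main w) => //; rewrite (setU1_id wXY).
have := rkU1_le hr w X; have := rkU1_le hr w Y.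
by case/setUP: wXY => /setU1_id ->; lia.
Qed.

Lemma bundle_repairable : r (L1 :&: L2) = 0 -> repairable r.
Proof.
move=> L12; pose k (Z : {set E + unit}) := r (lpart Z) + ((tt \in rpart Z) && ~~ m (lpart Z)).
have kE X (S : {set unit}) : k (join X S) = r X + ((tt \in S) && ~~ m X).
  by rewrite /k lpart_join rpart_join.
exists unit, k; split.
- exact: (modular_cut_rank hr mS mcl mI).
- by move=> X; rewrite kE inE addn0.
have mL1 : m L1 by apply/mP => z _; exact: subsetIl.
have mL2 : m L2 by apply/mP => z _; exact: subsetIr.
(* The line [L w] has rank at least 2 and so is not spanned by [w] alone. *)
have m0 : ~~ m set0.
  apply/negP => /mP h; have [w wP] := ex_nP.
  have := rk_mono hr (h w wP); rewrite rk_cl// => le.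
  by have := rL_ge2 wP; have := rkU1_le hr w set0; rewrite rk0//; lia.
exists L1, L2, (join set0 setT); split=> //.
- by rewrite joinU setU0 kE mL1 andbF addn0.
- by rewrite joinU setU0 kE mL2 andbF addn0.
by rewrite kE m0 inE rk0// rL1 rL2 rL12 L12.
Qed.

End Bundle.

(** * Repairable matroids are not sticky *)

Section Obstruction.
Context {E D : finType} {r : {set E} -> nat} {k : {set E + D} -> nat}.
Context {Q : {set E + D}}.
Hypotheses (hr : is_rank r) (hk : is_rank k).
Hypothesis kr : forall X, k (join X set0) = r X.

Implicit Types (X Y : {set E}).

Let c := r setT.
Let n := c + c + (k Q).+1.
Let kQ X := k (join X set0 :|: Q).

(* The restriction to [E] is [r]. The sets [A] and [B], of size [c + k Q], are
   placed freely in the spans of [Q] and [c] coloops, and then [Q] is deleted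
   and the rank is truncated to [n], which is too large for the spans of [A]
   and [B] to share [Q]. *)
Definition obstruction (A B : finType) (Z : {set (E + D) + (A + B)}) : nat :=
  let X := lpart (lpart Z) in
  let a := #|lpart (rpart Z)| in
  let b := #|rpart (rpart Z)| in
  minn (minn (r X + a + b) (kQ X + c + minn a b)) n.

Let kQ_ge X : k Q <= kQ X. Proof. by rewrite rk_mono// subsetUr. Qed.
Let kQ_ger X : r X <= kQ X. Proof. by rewrite -kr rk_mono// subsetUl. Qed.

Lemma obstruction_restrict A B X :
  @obstruction A B (join (join X set0) set0) = r X.
Proof.
rewrite /obstruction -join0 !lpart_join !rpart_join lpart_join.
rewrite !cards0 min0n !addn0.
by have := rk_mono hr (subsetT X); have := kQ_ger X; rewrite /n /c; lia.
Qed.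

Context {X0 Y0 : {set E}}.
Hypotheses (fX0 : fflat r X0) (fY0 : fflat r Y0).
Hypotheses (X0Q : k (join X0 set0 :|: Q) <= r X0) (Y0Q : k (join Y0 set0 :|: Q) <= r Y0).
Hypothesis XYlt : r (X0 :&: Y0) < k Q.

Let in_flat H X : fflat r H -> k (join H set0 :|: Q) <= r H -> kQ X <= k Q ->
  X \subset H.
Proof.
move=> fH HQ XQ; apply/subsetP => x xX; apply: (subsetP fH); rewrite in_cl// -(kr (x |: H)).
have XQcl : join X set0 \subset cl k Q by apply/sub_clP => //; rewrite setUC.
apply: leq_trans HQ; rewrite -[leqRHS](@rkU_cl _ _ hk _ (join X set0)).
  apply: rk_mono => //; apply/subsetP => -[y|y]; rewrite !inE ?orbF//.
  by case/orP => [/eqP->|->]; rewrite ?xX ?orbT.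
by apply: subset_trans XQcl _; apply: clS => //; exact: subsetUr.
Qed.

(** If [Q] spans [Y], then [Y] lies in [X0] and [Y0], whose intersection has rank below [k Q];
    otherwise [kQ Y] exceeds [k Q]. The gain of one pays for the truncation at [n] when one set is
    bounded through [A] and the other through [B]. *)
Let kQ_modular X Y : r (X :&: Y) + (k Q).+1 <= kQ X + kQ Y.
Proof.
have := kQ_ge X; have := kQ_ge Y; have := kQ_ger X.
have : r (X :&: Y) <= r X by rewrite rk_mono// subsetIl.
have [YQ|] := leqP (kQ Y) (k Q); last by lia.
have : r (X :&: Y) <= r (X0 :&: Y0).
  rewrite rk_mono//; apply: subset_trans (subsetIr _ _) _.
  by rewrite subsetI !in_flat.
by lia.
Qed.

Let kQ_submod X Y : kQ (X :|: Y) + kQ (X :&: Y) <= kQ X + kQ Y.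
Proof.
apply: (rk_submodP hk).
- by rewrite setUACA setUid joinU setU0.
- by rewrite setSU// joinS// subsetIl.
- by rewrite setSU// joinS// subsetIr.
Qed.

Let kQr_submod X Y : kQ (X :|: Y) + r (X :&: Y) <= kQ X + r Y.
Proof.
rewrite -!kr; apply: (rk_submodP hk).
- by rewrite setUAC joinU setU0.
- by apply: subset_trans (subsetUl _ _); rewrite joinS// subsetIl.
- by rewrite joinS// subsetIr.
Qed.

Let kQS X Y : X \subset Y -> kQ X <= kQ Y.
Proof. by move=> XY; rewrite /kQ (rk_mono hk)// setSU// joinS. Qed.

Lemma obstruction_rank A B : is_rank (@obstruction A B).
Proof.
split=> [Z|Z W ZW|Z W]; rewrite /obstruction.
- have := rk_card hr (lpart (lpart Z)).
  by rewrite (card_part Z) (card_part (lpart Z)) (card_part (rpart Z)); lia.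
- have XY := lpartS (lpartS ZW).
  have := rk_mono hr XY; have := kQS XY.
  have := subset_leq_card (lpartS (rpartS ZW)).
  by have := subset_leq_card (rpartS (rpartS ZW)); lia.
rewrite !(lpartU, rpartU, lpartI, rpartI).
move: (lpart (lpart Z)) (lpart (lpart W)) => X Y.
move: (lpart (rpart Z)) (lpart (rpart W)) => A1 A2.
move: (rpart (rpart Z)) (rpart (rpart W)) => B1 B2.
have := cardsUI A1 A2; have := cardsUI B1 B2.
have := subset_leq_card (subsetIl A1 A2); have := subset_leq_card (subsetIr A1 A2).
have := subset_leq_card (subsetIl B1 B2); have := subset_leq_card (subsetIr B1 B2).
have := rk_submod hr X Y; have := kQ_submod X Y.
have := kQr_submod X Y; have := kQr_submod Y X.
rewrite [Y :|: X]setUC [Y :&: X]setIC; have := kQ_modular X Y.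
have := rk_mono hr (subsetIl X Y); have := rk_mono hr (subsetIr X Y).
have := kQS (subsetIl X Y); have := kQS (subsetIr X Y).
move: (kQ _) (kQ _) (kQ _) (kQ _) (r _) (r _) (r _) (r _).
move: #|_| #|_| #|_| #|_| #|_| #|_| #|_| #|_|.
rewrite /n; move: (k Q) c; lia.
Qed.

Hypothesis XYQ : r X0 + r Y0 <= r (X0 :|: Y0) + k Q.

Lemma obstruction_no_amalgam (A B : finType) (a : {set (E + D) + (A + B)} -> nat) :
  #|A| = c + k Q -> #|B| = c + k Q -> is_rank a ->
  (forall Z, a (join Z set0) = k Z) ->
  (forall X S, a (join (join X set0) S) = obstruction (join (join X set0) S)) ->
  False.
Proof.
move=> cA cB ha ak ao.
have oE X (S : {set A}) (T : {set B}) : a (join (join X set0) (join S T)) =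
    minn (minn (r X + #|S| + #|T|) (kQ X + c + minn #|S| #|T|)) n.
  by rewrite ao /obstruction !lpart_join !rpart_join lpart_join.
have rT X : r X <= c by rewrite rk_mono// subsetT.
(* [Q] is in the span of [S] by modularity with the spans of [X0] and [Y0] over [S] *)
have Qspan (S : {set A}) (T : {set B}) : minn #|S| #|T| = 0 ->
    #|S| + #|T| = c + k Q -> a (join Q (join S T)) <= c + k Q.
  move=> ST0 ST.
  (* [H] spans [Q], so adding [Q] to [H] with [S] and [T] keeps the rank, which the second bound of
     the obstruction limits to [r H + c]. *)
  have up H : k (join H set0 :|: Q) <= r H ->
      a (join (join H set0 :|: Q) (join S T)) <= r H + c.
    move=> HQ.
    have := @rk_submodP _ _ ha (join (join H set0) (join S T))
      (join (join H set0 :|: Q) set0) (join (join H set0 :|: Q) (join S T))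
      (join (join H set0) set0).
    rewrite joinU setU0 setUA setUid subxx !joinS ?sub0set ?subsetUl// !ak oE ST0.
    by move=> /(_ isT isT isT); rewrite kr; move: HQ; rewrite -/(kQ H); lia.
  have := up _ X0Q; have := up _ Y0Q.
  have := @rk_submodP _ _ ha (join (join X0 set0 :|: Q) (join S T))
    (join (join Y0 set0 :|: Q) (join S T)) (join (join (X0 :|: Y0) set0) (join S T))
    (join Q (join S T)).
  rewrite joinU setUid setUACA joinU setU0 setUid !joinS ?subsetUr ?subsetUl//.
  move=> /(_ isT isT isT); rewrite oE ST0.
  by have := kQ_ger (X0 :|: Y0); have := rT (X0 :|: Y0); rewrite /n; lia.
have := Qspan setT set0; have := Qspan set0 setT.
rewrite !cardsT !cards0 minn0 min0n addn0 cA cB => /(_ erefl erefl) + /(_ erefl erefl).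
(* Each of [A] and [B] with [Q] has rank at most [c + k Q], and the two sets meet in [Q]. *)
have := rk_submod ha (join Q (join set0 setT)) (join Q (join setT set0)).
rewrite joinU joinI !setUid !setIid joinU joinI set0U setU0 set0I setI0.
rewrite join0 ak.
have : a (join (join set0 set0) (join setT setT)) <= a (join Q (join setT setT)).
  by apply: rk_mono => //; apply: joinS => //; rewrite join0 sub0set.
(* As [k Q] is positive, [A] and [B] together reach the truncation value [n]. *)
rewrite oE !cardsT cA cB rk0//; have := kQ_ge set0; have := XYlt; rewrite /n.
move: (a _) (a _) (a _); lia.
Qed.

End Obstruction.

(** * Transfer to matroids *)

From mathcomp Require Import boolp classical_sets functions cardinality.

Local Open Scope classical_set_scope.
Local Open Scope card_scope.

Lemma card_finset_le (E : finType) (X : {set E}) : [set` X] #<= `I_#|X|.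
Proof.
have [->|[x0 _]] := set_0Vmem X.
  rewrite (_ : [set` finset.set0] = set0) ?card_ge0//.
  by apply/seteqP; split=> x //=; rewrite finset.inE.
apply: card_le_trans (card_image_le (nth x0 (enum X)) `I_#|X|).
apply: subset_card_le => x /= xX; exists (index x (enum X)).
  by rewrite /= cardE index_mem mem_enum.
by rewrite nth_index// mem_enum.
Qed.

Lemma card_le_finset (E : finType) (X : {set E}) n :
  [set` X] #<= `I_n -> #|X| <= n.
Proof.
rewrite -card_le_II; apply: card_le_trans.
have [X0|[x0 x0X]] := set_0Vmem X.
  by rewrite X0 cards0 II0 card_ge0.
apply: card_le_trans (card_image_le (fun x => index x (enum X)) [set` X]).
apply: subset_card_le => i /= iX; exists (nth x0 (enum X) i).
  by rewrite /= -mem_enum mem_nth// -cardE.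
by rewrite index_uniq// ?enum_uniq// -cardE.
Qed.

Lemma finite_set_enum (T : Type) (A : set T) : finite_set A ->
  exists (D : finType) (f : D -> T), injective f /\ forall x, A x <-> exists i, f i = x.
Proof.
move=> [n]; rewrite card_eq_sym => /card_bijP[f [f' fK f'K]].
exists 'I_n, (fun i => set_val (f (ordII i))); split.
  move=> i j /val_inj /(can_inj fK) h.
  by apply/val_inj; have := congr1 val h.
move=> x; split=> [Ax|[i <-]]; last exact: set_valP.
exists (IIord (f' (SigSub (mem_set Ax)))).
have -> : ordII (IIord (f' (SigSub (mem_set Ax)))) = f' (SigSub (mem_set Ax)) by apply/val_inj.
by rewrite f'K.
Qed.

(** [g] may fail to be injective, repeated points being parallel copies; spanned points can thus be
    added without checking that they are new. *)
Definition pull (U : Type) (N : matroid U) (E : finType) (g : E -> U) (X : {set E}) : nat :=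
  rank N (g @` [set` X]).

Section Pull.
Context {U : Type} {N : matroid U} {E : finType} {g : E -> U}.
Hypothesis hg : forall x, ground N (g x).

Lemma image_ground (X : set E) : g @` X `<=` ground N.
Proof. by move=> _ [x _ <-]. Qed.

Lemma pull_rank : is_rank (pull N g).
Proof.
split=> [X|X Y XY|X Y]; rewrite /pull.
- apply: rank_card; first exact: image_ground.
  exact: card_le_trans (card_image_le _ _) (card_finset_le X).
- apply: rank_mono; last exact: image_ground.
  by apply: image_subset => x /=; apply: (fintype.subsetP XY).
apply: leq_trans (rank_submod (image_ground (X := [set` X])) (image_ground (X := [set` Y]))).
apply: leq_add; apply: rank_mono.
- move=> _ [x /= + <-]; rewrite finset.inE => /orP[h|h]; [left|right]; exact: imageP.
- by move=> u [/image_ground|/image_ground].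
- by move=> _ [x /= + <-]; rewrite finset.inE => /andP[h1 h2]; split; exact: imageP.
by move=> u [/image_ground].
Qed.

End Pull.

Definition finset_of (U : finType) (A : set U) : {set U} := finset (fun x => `[<A x>]).

Lemma in_finset_of (U : finType) (A : set U) x : (x \in finset_of A) = `[<A x>].
Proof. by rewrite finset.inE. Qed.

Lemma finset_ofK (U : finType) (X : {set U}) : finset_of [set` X] = X.
Proof. by apply/setP => x; rewrite in_finset_of /= asboolb. Qed.

Lemma set_finset_of (U : finType) (A : set U) : [set` finset_of A] = A.
Proof.
apply/seteqP; split=> x; first change (x \in finset_of A -> A x).
  by rewrite in_finset_of => /asboolP.
by move=> Ax; change (x \in finset_of A); rewrite in_finset_of; apply/asboolP.
Qed.

Section FinMatroid.
Context {U : finType} (r : {set U} -> nat) (G : {set U}).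
Hypothesis hr : is_rank r.

Let rA (A : set U) := r (finset_of A).

Let finset_ofS (A B : set U) : A `<=` B -> finset_of A \subset finset_of B.
Proof.
by move=> AB; apply/fintype.subsetP => x; rewrite !in_finset_of => /asboolP/AB/asboolP.
Qed.

Fact fin_rank_card (X : set U) n : X `<=` [set` G] -> X #<= `I_n -> rA X <= n.
Proof.
move=> _; rewrite -[X in X #<= _](set_finset_of X) => /card_le_finset.
exact: leq_trans (rk_card hr _).
Qed.

Fact fin_rank_mono (X Y : set U) : X `<=` Y -> Y `<=` [set` G] -> rA X <= rA Y.
Proof. by move=> XY _; apply: rk_mono => //; exact: finset_ofS. Qed.

Fact fin_rank_submod (X Y : set U) : X `<=` [set` G] -> Y `<=` [set` G] ->
  rA (X `|` Y) + rA (X `&` Y) <= rA X + rA Y.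
Proof.
move=> _ _; apply: (rk_submodP hr); last by apply: finset_ofS => x [].
  apply/fintype.subsetP => x; rewrite finset.in_setU !in_finset_of => /asboolP.
  by case=> /asboolP->; rewrite ?orbT.
by apply: finset_ofS => x [].
Qed.

Fact fin_rank_finitary (X : set U) : X `<=` [set` G] ->
  exists F, [/\ F `<=` X, finite_set F & rA F = rA X].
Proof. by move=> _; exists X; split=> //; exact: finite_finset. Qed.

(** The rank function lives on the whole type and [G] selects the ground set, so that two matroids
    on one type can overlap partially. *)
Definition fin_matroid : matroid U :=
  Matroid fin_rank_card fin_rank_mono fin_rank_submod fin_rank_finitary.

Lemma fin_matroidE (A : set U) : rank fin_matroid A = r (finset_of A).
Proof. by []. Qed.

End FinMatroid.

(** * Closures in possibly infinite matroids *)

Definition matroid_closure (U : Type) (K : matroid U) (A : set U) : set U :=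
  [set e | ground K e /\ rank K (A `|` [set e]) <= rank K A].

Definition sum_map (E D : finType) (U : Type) (g : E -> U) (q : D -> U) (u : E + D) : U :=
  match u with inl x => g x | inr d => q d end.

Section Closure.
Context {U : Type} {K : matroid U} {E : finType} {g : E -> U}.
Hypothesis hg : forall x, ground K (g x).
Implicit Types (X Y : {set E}).

Lemma pull_join0 (D : finType) (q : D -> U) X :
  pull K (sum_map g q) (join X finset.set0) = pull K g X.
Proof.
rewrite /pull; congr (rank K _); apply/seteqP; split=> [_ [[x|x] /= + <-]|_ [x /= xX <-]].
- by rewrite finset.inE => xX; exists x.
- by rewrite !finset.inE.
by exists (inl x) => //=; rewrite finset.inE.
Qed.

Lemma sum_map_ground (D : finType) (q : D -> U) :
  (forall d, ground K (q d)) -> forall u, ground K (sum_map g q u).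
Proof. by move=> hq [x|d] /=. Qed.

Lemma pull_join_closure (D : finType) (q : D -> U) X :
  (forall d, matroid_closure K (g @` [set` X]) (q d)) ->
  pull K (sum_map g q) (join X finset.setT) <= pull K g X.
Proof.
move=> hq; have hk := pull_rank (sum_map_ground (fun d => proj1 (hq d))).
rewrite -(pull_join0 q) -(@rkU_cl _ _ hk (join X finset.set0) (join finset.set0 finset.setT)).
  by rewrite joinU finset.setU0 finset.set0U.
apply/fintype.subsetP => -[x|d]; first by rewrite !finset.inE.
move=> _; rewrite (in_cl hk) pull_join0; have [_] := hq d; apply: leq_trans.
apply: rank_mono.
  move=> _ [[x|d'] /= + <-]; rewrite !finset.inE /= => h; first by left; exists x.
  by right; move: h; rewrite orbF => /eqP[->].
move=> u [/(image_ground hg)//|->]; by case: (hq d).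
Qed.

Lemma closure_ground A : matroid_closure K A `<=` ground K.
Proof. by move=> e []. Qed.

Lemma sub_closure A : A `<=` ground K -> A `<=` matroid_closure K A.
Proof.
move=> AK e Ae; split; first exact: AK.
by rewrite (_ : A `|` [set e] = A)//; apply/setUidPl => _ ->.
Qed.

Lemma closureS A B : A `<=` B -> B `<=` ground K -> matroid_closure K A `<=` matroid_closure K B.
Proof.
move=> AB BK e [eK Ae]; split=> //.
have AeK : A `|` [set e] `<=` ground K by move=> u [/AB/BK//|->].
have := rank_submod AeK BK.
have : rank K (B `|` [set e]) <= rank K (A `|` [set e] `|` B).
  by apply: rank_mono => u; [case=> [|->]; [right|left; right]|case=> [/AeK|/BK]].
have : rank K A <= rank K ((A `|` [set e]) `&` B).
  by apply: rank_mono => [u Au|u [_ /BK//]]; split; [left|exact: AB].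
by lia.
Qed.

(** The closure may be infinite; the finitary axiom replaces it by a finite subset, which adds no
    rank to [X]. *)
Lemma rank_closure X : rank K (matroid_closure K (g @` [set` X])) = pull K g X.
Proof.
apply/anti_leq/andP; split; last first.
  by apply: rank_mono; [apply: sub_closure; exact: image_ground|exact: closure_ground].
have [F [FX /finite_set_enum[D [q [_ qF]]] <-]] := rank_finitary (@closure_ground (g @` [set` X])).
have hq d : matroid_closure K (g @` [set` X]) (q d) by apply: FX; apply/qF; exists d.
apply: leq_trans (pull_join_closure hq); apply: rank_mono.
  by move=> u /qF[d <-]; exists (inr d); rewrite //= !finset.inE.
by apply: image_ground; apply: sum_map_ground => d; case: (hq d).
Qed.

Lemma closure_flat X : flat K (matroid_closure K (g @` [set` X])).
Proof.
split=> [|e eK]; first exact: closure_ground.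
apply: contra_notT; rewrite -leqNgt rank_closure => h; split=> //.
apply: leq_trans h; apply: rank_mono.
  by move=> u [|->]; [left; apply: sub_closure => //; exact: image_ground|right].
by move=> u [[]|->].
Qed.

(** The closures of [X] and [Y] in [K] are modular, and a finite subset carrying the rank of their
    intersection is the repairing set. *)
Lemma modular_extension_repairable X Y :
  modular K -> nonmodular_pair (pull K g) X Y -> repairable (pull K g).
Proof.
move=> modK [fX fY XY].
have hr := pull_rank hg.
have := modK _ _ (closure_flat X) (closure_flat Y); rewrite !rank_closure.
set CX := matroid_closure K (g @` [set` X]); set CY := matroid_closure K (g @` [set` Y]).
have CIK : CX `&` CY `<=` ground K by move=> u [[]].
have [F [FXY /finite_set_enum[D [q [_ qF]]] <-]] := rank_finitary CIK.
have : rank K (CX `|` CY) <= pull K g (X :|: Y).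
  rewrite -rank_closure; apply: rank_mono; last exact: closure_ground.
  have gS (Z : {set E}) : Z \subset X :|: Y ->
      matroid_closure K (g @` [set` Z]) `<=` matroid_closure K (g @` [set` X :|: Y]).
    move=> /fintype.subsetP ZXY; apply: closureS; last exact: image_ground.
    by apply: image_subset => z /=; apply: ZXY.
  by move=> u [|]; apply: gS; rewrite ?finset.subsetUl ?finset.subsetUr.
have hqX d : CX (q d) by have [] : (CX `&` CY) (q d) by apply: FXY; apply/qF; exists d.
have hqY d : CY (q d) by have [] : (CX `&` CY) (q d) by apply: FXY; apply/qF; exists d.
have <- : pull K (sum_map g q) (join finset.set0 finset.setT) = rank K F.
  rewrite /pull; congr (rank K _); apply/seteqP; split=> [_ [[x|d] /= + <-]|u /qF[d <-]].
  - by rewrite !finset.inE.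
  - by move=> _; apply/qF; exists d.
  by exists (inr d); rewrite //= !finset.inE.
move=> CXY mod; exists D, (pull K (sum_map g q)); split.
- by apply: pull_rank; apply: sum_map_ground => d; case: (hqX d).
- exact: pull_join0.
exists X, Y, (join finset.set0 finset.setT); split=> //.
- by rewrite joinU finset.setU0 finset.set0U; exact: pull_join_closure.
- by rewrite joinU finset.setU0 finset.set0U; exact: pull_join_closure.
by split; lia.
Qed.

End Closure.

(** * Translation between rank functions on finite types and matroids *)

Lemma finset_ofU1 (U : finType) (A : set U) e :
  finset_of (A `|` [set e]) = e |: finset_of A.
Proof.
apply/setP => x; rewrite !finset.inE; apply/asboolP/orP => [[/asboolP|->]|[/eqP->|/asboolP]];
  by [right|left; rewrite eqxx|right|left].
Qed.

Lemma finset_ofI (U : finType) (A B : set U) :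
  finset_of (A `&` B) = finset_of A :&: finset_of B.
Proof.
apply/setP => x; rewrite !finset.inE.
by apply/asboolP/andP => [[/asboolP ? /asboolP]|[/asboolP ? /asboolP]].
Qed.

Lemma fin_flatP (U : finType) (r : {set U} -> nat) (hr : is_rank r) (A : set U) :
  flat (fin_matroid finset.setT hr) A <-> fflat r (finset_of A).
Proof.
split=> [[_ fA]|fA].
  apply/fintype.subsetP => x; rewrite (in_cl hr) in_finset_of => xA.
  apply/asboolP; apply: contrapT => nA.
  have := fA x; rewrite /= finset.inE => /(_ isT nA).
  by rewrite ?fin_matroidE finset_ofU1; lia.
split=> [x _|e _ nA]; first by rewrite /= finset.inE.
rewrite !fin_matroidE finset_ofU1 (rkU1_ncl hr)//.
apply/negP => /(fintype.subsetP fA); rewrite in_finset_of => /asboolP.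
exact: nA.
Qed.

Lemma isomorphic_pull (T U : Type) (M : matroid T) (N : matroid U) (E : finType)
    (f : E -> T) : (forall x, ground M (f x)) -> isomorphic M N ->
  exists2 g : E -> U, (forall x, ground N (g x)) & pull N g =1 pull M f.
Proof.
move=> fM [h _ hrk].
exists (fun x => set_val (h (SigSub (mem_set (fM x))))) => [x|X].
  exact: set_valP.
have -> : pull M f X = rank M (set_val @` [set SigSub (mem_set (fM x)) | x in [set` X]]).
  rewrite /pull image_comp; congr (rank M _).
rewrite -hrk /pull; congr (rank N _).
by rewrite !image_comp.
Qed.

Lemma pull_isomorphic (T U : Type) (M : matroid T) (N : matroid U) (E : finType)
    (f : E -> T) (g : E -> U) :
  injective f -> injective g ->
  (forall y, ground M y <-> exists x, f x = y) ->
  (forall y, ground N y <-> exists x, g x = y) ->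
  pull N g =1 pull M f -> isomorphic M N.
Proof.
move=> fI gI fM gN rk.
have fS (y : ground M) : {x | f x = set_val y}.
  by apply: cid; apply/fM; exact: set_valP.
have gS (y : ground N) : {x | g x = set_val y}.
  by apply: cid; apply/gN; exact: set_valP.
have Mf x : ground M (f x) by apply/fM; exists x.
have Ng x : ground N (g x) by apply/gN; exists x.
pose h y : ground N := SigSub (mem_set (Ng (sval (fS y)))).
pose h' y : ground M := SigSub (mem_set (Mf (sval (gS y)))).
exists h.
  exists h' => y; apply/val_inj; rewrite /h /h' /=.
    by case: (gS _) => x /= /gI ->; case: (fS y).
  by case: (fS _) => x /= /fI ->; case: (gS y).
move=> X; pose S := finset_of [set x | exists2 y, X y & sval (fS y) = x].
have -> : set_val @` (h @` X) = g @` [set` S].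
  rewrite image_comp /S set_finset_of; apply/seteqP; split=> [_ [y Xy <-]|_ [_ [y Xy <-] <-]].
    by exists (sval (fS y)) => //; exists y.
  by exists y.
have -> : set_val @` X = f @` [set` S].
  rewrite /S set_finset_of; apply/seteqP; split=> [_ [y Xy <-]|_ [_ [y Xy <-] <-]].
    by exists (sval (fS y)); [exists y|case: (fS y)].
  by exists y => //; case: (fS y).
exact: rk.
Qed.

(** * Induction on the rank, and conclusion *)

Lemma fin_matroid_planes (E : finType) (r : {set E} -> nat) (hr : is_rank r) :
  r finset.setT = 4 ->
  (forall X Y, fflat r X -> fflat r Y -> r X = 3 -> r Y = 3 ->
     r X + r Y <= r (X :|: Y) + r (X :&: Y)) ->
  let M := fin_matroid finset.setT hr in
  forall P Q : set E, plane M P -> plane M Q -> P <> Q -> flat_of_rank M 2 (P `&` Q).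
Proof.
move=> r4 mod M P Q [/fin_flatP fP rP] [/fin_flatP fQ rQ] PQ.
rewrite !fin_matroidE in rP rQ.
split; first by apply/fin_flatP; rewrite finset_ofI; exact: flatI.
rewrite fin_matroidE finset_ofI.
have := mod _ _ fP fQ rP rQ; have := rk_mono hr (finset.subsetT (finset_of P :|: finset_of Q)).
(* The intersection has rank at least 3 + 3 - 4 = 2; above 2, both planes would equal it. *)
rewrite r4 rP rQ; have [|lt2 _ _] := leqP (r (finset_of P :&: finset_of Q)) 2; first by lia.
case: PQ; rewrite -(set_finset_of P) -(set_finset_of Q); suff -> : finset_of P = finset_of Q by [].

have fI := flatI hr fP fQ.
transitivity (finset_of P :&: finset_of Q); [symmetry|].
  by apply: (flat_rk_eq hr fI (finset.subsetIl _ _)); rewrite rP.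
by apply: (flat_rk_eq hr fI (finset.subsetIr _ _)); rewrite rQ.
Qed.

Lemma repairable_of_modular_extension (E : finType) (r : {set E} -> nat) (hr : is_rank r) :
  has_modular_extension (fin_matroid finset.setT hr) -> ~ fin_modular r -> repairable r.
Proof.
move=> [U [M' [K [iso [M'K [gE rE]] modK]]]] /fin_modularPn[X [Y nXY]].
have idM x : ground (fin_matroid finset.setT hr) (idfun x) by rewrite /= finset.inE.
have [g hg gr] := isomorphic_pull idM iso.
have hgK x : ground K (g x) by exact: M'K.
have pullE : pull K g = r.
  apply/funext => Z; transitivity (pull M' g Z).
    apply: rE => _ [z _ <-]; split; [exact: hgK|exact: hg].
  by rewrite gr /pull image_id fin_matroidE finset_ofK.
by rewrite -pullE; apply: (modular_extension_repairable hgK modK); rewrite pullE; exact: nXY.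
Qed.

(** Rank 4 with pairwise modular planes is left as a premise, to be supplied by the hypothesis on
    planes. *)
Lemma nonmodular_repairable
  (rank4 : forall (E : finType) (r : {set E} -> nat), is_rank r -> r finset.setT = 4 ->
     (forall X Y, fflat r X -> fflat r Y -> r X = 3 -> r Y = 3 ->
        r X + r Y <= r (X :|: Y) + r (X :&: Y)) ->
     ~ fin_modular r -> repairable r)
  (E : finType) (r : {set E} -> nat) :
  is_rank r -> ~ fin_modular r -> repairable r.
Proof.
have [n] := ubnP (r finset.setT); elim: n r => // n IHn r; rewrite ltnS => rn hr nmod.
have [[e [re nmode]]|loc] := pselect (exists e, r [set e]%SET = 1 /\ ~ fin_modular (contract r e)).
  apply: (repairable_contract hr re); apply: IHn => //; last exact: contract_rank.
  by rewrite /contract re finset.setUT; have := rk_mono hr (finset.subsetT [set e]%SET); lia.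
have {}loc e : r [set e]%SET = 1 -> fin_modular (contract r e).
  by move=> re; apply: contrapT => h; apply: loc; exists e.
have [[X [Y [nXY rX rY]]]|hyp] := pselect (exists X Y, [/\ nonmodular_pair r X Y,
    (r X).+1 = r finset.setT & (r Y).+1 = r finset.setT]).
  exact: (repairable_hyperplanes hr nXY).
have {}hyp X Y : fflat r X -> fflat r Y -> (r X).+1 = r finset.setT ->
    (r Y).+1 = r finset.setT -> r X + r Y <= r (X :|: Y) + r (X :&: Y).
  move=> fX fY rX rY; rewrite leqNgt; apply/negP => XY.
  by apply: hyp; exists X, Y.
have [L1 [L2 [fL1 fL2 rL1 rL2 [rU rI]]]] := ex_disjoint_coplanar_lines hr loc nmod.
have r3 : 3 <= r finset.setT by rewrite -rU; apply: rk_mono => //; exact: finset.subsetT.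
have [r5|] := leqP 5 (r finset.setT).
  (* The planes spanned by [z] and each line share the nonloop [z], so they are modular and meet in
     rank at least 3 + 3 - 4 = 2. *)
  apply: (bundle_repairable hr r5 fL1 fL2 rL1 rL2 rU _ rI) => z zP.
  set V1 := cl r (z |: L1); set V2 := cl r (z |: L2).
  have zV L : z \in cl r (z |: L) by rewrite (fintype.subsetP (sub_cl _))// finset.setU11.
  have z1 : r [set z]%SET = 1.
    have : z \notin cl r finset.set0.
      by apply: contra zP; apply: fintype.subsetP; apply: clS => //; exact: finset.sub0set.
    by move=> /(rkU1_ncl hr); rewrite finset.setU0 rk0.
  have rV (L : {set E}) : L \subset L1 :|: L2 -> r (cl r (z |: L)) = (r L).+1.
    move=> LL; rewrite (rk_cl hr) rkU1_ncl//.
    by apply: contra zP; apply: fintype.subsetP; exact: clS.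
  have := locally_modular_pair hr loc (cl_flat hr (z |: L1)) (cl_flat hr (z |: L2)).
  rewrite -/V1 -/V2 (rV _ (finset.subsetUl _ _)) (rV _ (finset.subsetUr _ _)) rL1 rL2.
  have rLL : r (cl r (z |: (L1 :|: L2))) = 4 by rewrite rV ?rU.
  have -> : r (V1 :|: V2) = 4.
    apply/anti_leq/andP; split.
      rewrite -rLL; apply: rk_mono => //.
      rewrite finset.subUset; apply/andP; split; apply: clS => //; apply: finset.setUS.
        exact: finset.subsetUl.
      exact: finset.subsetUr.
    rewrite -rLL (rk_cl hr); apply: rk_mono => //.
    rewrite finset.subUset finset.sub1set finset.inE zV /=.
    apply: finset.setUSS; apply: fintype.subset_trans (finset.subsetUr _ _) (sub_cl _).
  have : 0 < r (V1 :&: V2).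
    by rewrite -z1; apply: rk_mono => //; rewrite finset.sub1set finset.inE !zV.
  by move=> h /(_ h); lia.
rewrite ltnS leq_eqVlt => /orP[/eqP r4|r_lt4].
  by apply: rank4 => // X Y fX fY rX rY; apply: hyp => //; rewrite ?rX ?rY r4.
(* In rank 3 the lines [L1] and [L2] are a nonmodular pair of hyperplanes, which is already
   excluded. *)
have r3' : r finset.setT = 3 by lia.
by have := hyp _ _ fL1 fL2; rewrite rL1 rL2 rU rI r3' => /(_ erefl erefl).
Qed.

Lemma modular_of_pull (T : Type) (M : matroid T) (E : finType) (f : E -> T) :
  (forall x, ground M x <-> exists i, f i = x) -> injective f ->
  fin_modular (pull M f) -> modular M.
Proof.
move=> fM fI mod; have hf i : ground M (f i) by apply/fM; exists i.
have hr := pull_rank hf.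
pose pre (A : set T) := finset_of (f @^-1` A).
have preK A : A `<=` ground M -> f @` [set` pre A] = A.
  move=> AM; rewrite set_finset_of; apply/seteqP; split=> [_ [i Ai <-]//|x Ax].
  by have /fM[i ix] := AM _ Ax; exists i; rewrite //= ix.
have rkE A : A `<=` ground M -> rank M A = pull M f (pre A).
  by move=> AM; rewrite /pull preK.
have flatE A : flat M A -> fflat (pull M f) (pre A).
  move=> [AM fA]; apply/fintype.subsetP => i; rewrite (in_cl hr) in_finset_of => iA.
  apply/asboolP; apply: contrapT => nA; have := fA _ (hf i) nA.
  have -> : rank M (A `|` [set f i]) = pull M f (i |: pre A).
    rewrite rkE; last by move=> x [/AM|->].
    congr (pull M f _); rewrite -finset_ofU1; congr finset_of.
    by apply/seteqP; split=> [j [|/fI]|j [|->]]; [left|right|left|right].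
  by rewrite rkE//; lia.
move=> A B fA fB; have [AM _] := fA; have [BM _] := fB.
have UM : A `|` B `<=` ground M by move=> x [/AM|/BM].
have IM : A `&` B `<=` ground M by move=> x [/AM].
apply/anti_leq/andP; split; last exact: rank_submod.
rewrite (rkE _ AM) (rkE _ BM); apply: leq_trans (mod _ _ (flatE _ fA) (flatE _ fB)) _.
rewrite (rkE _ UM) (rkE _ IM); apply: leq_add; rewrite (rk_mono hr)//.
  apply/fintype.subsetP => i; rewrite finset.in_setU !in_finset_of.
  by case/orP => /asboolP h; apply/asboolP; [left|right].
by rewrite /pre preimage_setI finset_ofI.
Qed.

(** The extension and the obstruction are put on the common type [(E + D) + (A + A)], where their
    ground sets meet in the copy of [E]. *)
Lemma sticky_not_repairable (T : Type) (M : matroid T) (E : finType) (f : E -> T) :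
  (forall x, ground M x <-> exists i, f i = x) -> injective f ->
  sticky M -> ~ repairable (pull M f).
Proof.
move=> fM fI stM; have hf i : ground M (f i) by apply/fM; exists i.
have hr := pull_rank hf; have [r rM] : exists r, r = pull M f by exists (pull M f).
rewrite -rM in hr *.
move=> [D [k [hk kr [X0 [Y0 [Q [fX0 fY0 X0Q Y0Q [XYQ XYlt]]]]]]]].
pose A : finType := 'I_(r finset.setT + k Q).
have cA : #|A| = r finset.setT + k Q by rewrite card_ord.
pose ob := @obstruction E D r k Q A A.
have hob : is_rank ob := obstruction_rank hr hk kr fX0 fY0 X0Q Y0Q XYlt A A.
(* The elements of [A + A] are loops for this function and lie outside the ground set of [N]. *)
have hk' : is_rank (fun Z : {set (E + D) + (A + A)} => k (lpart Z)).
  apply: (is_rank_join (g := fun Z _ => k Z)) => [Z S|Z W S S' ZW _|Z W S S'].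
  - by apply: leq_trans (rk_card hk _) (leq_addr _ _).
  - exact: rk_mono.
  exact: rk_submod.
pose N := fin_matroid (join finset.setT finset.set0) hk'.
pose N' := fin_matroid (join (join finset.setT finset.set0) finset.setT) hob.
pose I := ground N `&` ground N'.
pose h (x : E) : (E + D) + (A + A) := inl (inl x).
have IE u : I u <-> exists x, h x = u.
  split=> [[]|[x <-]]; last by split; rewrite /= /h !finset.inE.
  by move: u => [[x|d]|a]; rewrite /= !finset.inE//; exists x.
have joinP (Z : set ((E + D) + (A + A))) : Z `<=` I ->
    exists X, finset_of Z = join (join X finset.set0) finset.set0.
  move=> ZI; exists (lpart (lpart (finset_of Z))); apply/setP => u.
  rewrite !finset.inE; case: u => [[x|d]|a]; rewrite ?finset.inE//.
    by apply/asboolP => /ZI/IE[].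
  by apply/asboolP => /ZI/IE[].
have NN' Z : Z `<=` I -> rank N Z = rank N' Z.
  move=> /joinP[X ZX]; rewrite !fin_matroidE ZX lpart_join kr.
  by rewrite /ob (obstruction_restrict hr hk kr).
have [||Am [gA [_ rN] [_ rN']]] := stM _ N N'.
- split=> [|Z ZI]; first by apply/seteqP; split=> u [u1 [u2 u3]]; split.
  by apply: NN' => u /ZI[].
- apply: (@pull_isomorphic _ _ _ _ E h f) => //.
  + by move=> x y; rewrite /h => -[].
  + by move=> u; rewrite -IE; split=> [[]|[]].
  move=> X; rewrite -rM -(kr X); congr (k _); apply/setP => -[x|d].
    rewrite !finset.inE; apply/idP/asboolP => [xX|[y yX [<-//]]].
    by exists x.
  by rewrite !finset.inE; apply/esym/negbTE/asboolP => -[].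
have gT u : ground Am u.
  by rewrite gA; case: u => [u|a]; [left|right]; rewrite /= !finset.inE.
have ha := pull_rank gT.
apply: (obstruction_no_amalgam hr hk kr fX0 fY0 X0Q Y0Q XYlt XYQ cA cA ha) => [Z|X S].
  transitivity (rank N [set` join Z finset.set0]).
    rewrite /pull image_id; apply: rN => u uZ; split; first exact: gT.
    by move: uZ; case: u => u; rewrite /= !finset.inE.
  by rewrite fin_matroidE finset_ofK lpart_join.
transitivity (rank N' [set` join (join X finset.set0) S]); last by rewrite fin_matroidE finset_ofK.
rewrite /pull image_id; apply: rN' => u uZ; split; first exact: gT.
by move: uZ; case: u => [[u|u]|u]; rewrite /= !finset.inE.
Qed.

Theorem mainTheorem3
  (planes_hyp : forall (T : Type) (M : matroid T),
     finite_matroid M ->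
     matroid_rank M = 4 ->
     (forall P Q : set T, plane M P -> plane M Q -> P <> Q ->
        flat_of_rank M 2 (P `&` Q)) ->
     has_modular_extension M)
  (T : Type) (M : matroid T) :
  finite_matroid M -> sticky M -> modular M.
Proof.
move=> /finite_set_enum[E [f [fI fM]]] stM.
apply: (modular_of_pull fM fI); apply: contrapT.
have hr : is_rank (pull M f) by apply: pull_rank => x; apply/fM; exists x.
move=> /(nonmodular_repairable _ hr) rep; apply: (sticky_not_repairable fM fI stM).
(* The premise in rank 4: the hypothesis on planes extends the matroid of [r] to a modular one,
   which repairs it. *)
apply: rep => D r hD r4 hyp; apply: (repairable_of_modular_extension (hr := hD)).
apply: planes_hyp; first exact: finite_finset.
  by rewrite /matroid_rank fin_matroidE finset_ofK.
exact: fin_matroid_planes.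
Qed.
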